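(* Let $\mathcal{H}$ be a complex Hilbert space, let $A\in\mathbb{B}(\mathcal{H})$ be a positive operator, and let $T,S\in\mathbb{B}_{A^{1/2}}(\mathcal{H})$. Then $$d_A(T,\mathbb{C}S)=\sup\Big\{|\langle Tx,y\rangle_A| :\ \|x\|_A=\|y\|_A=1,\ Sx\perp_A y\Big\},$$ where $d_A(T,\mathbb{C}S)=\inf_{\gamma\in\mathbb{C}}\|T+\gamma S\|_A$ and $x,y$ range over $\mathcal{H}$.
   Context: $\mathbb{B}(\mathcal{H})$ denotes the bounded linear operators on the complex Hilbert space $(\mathcal{H},\langle\cdot,\cdot\rangle)$. An operator $A\in\mathbb{B}(\mathcal{H})$ is positive if $\langle Ax,x\rangle\ge 0$ for all $x\in\mathcal{H}$. Put $\langle x,y\rangle_A=\langle Ax,y\rangle$ and $\|x\|_A=\sqrt{\langle x,x\rangle_A}$ (a seminorm); $x\perp_A y$ means $\langle x,y\rangle_A=0$. $\mathbb{B}_{A^{1/2}}(\mathcal{H})$ is the set of $T\in\mathbb{B}(\mathcal{H})$ for which there is $c>0$ with $\|Tx\|_A\le c\|x\|_A$ for all $x\in\mathcal{H}$. For such $T$, $\|T\|_A=\sup\{\|Tx\|_A/\|x\|_A:\ x\in\overline{\mathcal{R}(A)},\ x\ne 0\}=\inf\{c>0:\ \|Tx\|_A\le c\|x\|_A \text{ for all } x\in\mathcal{H}\}$, where $\overline{\mathcal{R}(A)}$ is the norm closure of the range of $A$. *)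

(* Defs.v *)
From HB Require Import structures.
From mathcomp Require Import all_boot all_order all_algebra.
From mathcomp Require Import all_classical all_reals all_analysis.
From mathcomp Require Import complex.

Set Implicit Arguments.
Unset Strict Implicit.
Unset Printing Implicit Defensive.

Import Order.TTheory GRing.Theory Num.Theory.
Import numFieldNormedType.Exports.

Local Open Scope classical_set_scope.
Local Open Scope ring_scope.
Local Open Scope complex_scope.

(* A complex Hilbert space is a complete normed module over R[i] whose norm is
   induced by an inner product.  Forms in {dot H for Num.conj} are linear in
   the first argument and conjugate-linear in the second one. *)
Definition induces_norm (R : realType) (H : completeNormedModType R[i])
    (dot : {dot H for (@Num.conj R[i])}) : Prop :=
  forall x : H, `|x| ^+ 2 = dot x x.

(* [0 <= z] in R[i] means that z is real and nonnegative. *)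
Definition positive_op (R : realType) (H : completeNormedModType R[i])
    (dot : {dot H for (@Num.conj R[i])}) (A : H -> H) : Prop :=
  forall x : H, 0 <= dot (A x) x.

Section semi_inner_product.
Context (R : realType) (H : completeNormedModType R[i]).
Context (dot : {dot H for (@Num.conj R[i])}) (A : H -> H).
Implicit Types (x y : H) (T S : H -> H).

Definition dotA x y : R[i] := dot (A x) y.

(* For positive A, [dotA x x] is a nonnegative real, so that taking its real
   part only moves it from R[i] to R. *)
Definition seminormA x : R := Num.sqrt (complex.Re (dotA x x)).

Definition orthA x y : Prop := dotA x y = 0.

Definition A_bounded T : Prop :=
  exists2 c : R, 0 < c & forall x, seminormA (T x) <= c * seminormA x.

(* Since [sup set0 = 0], this is 0 when A = 0, as is the infimum of all c > 0
   such that [seminormA (T x) <= c * seminormA x] for all x. *)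
Definition opnormA T : R :=
  sup [set seminormA (T x) / seminormA x |
        x in [set x | closure (range A) x /\ x != 0]].

Definition distA T S : R :=
  inf [set opnormA (T \+ gamma \*: S) | gamma in [set: R[i]]].

End semi_inner_product.

(* Main.v *)
(* Write n(x) = <x,x>_A.  The supremum M on the right is the supremum over A-unit
   vectors x of the distance from Tx to the line C Sx, so M <= |T + g S|_A for
   every g, and the converse is a minimax statement: one g must serve all x.  In
   other words the discs {g : n(Tx + g Sx) <= M^2 n(x)} must have a common point.
   If some Sx0 is not A-null, the disc of x0 is compact, and finitely many x
   suffice.  For these minimise the sum of max(0, n(Tx + g Sx) - M^2 n(x))^2 over
   g.  If the minimum is positive, stationarity says that sum w_x <Ux, Sx>_A = 0,
   where U = T + g S and the w_x >= 0 are the positive parts.  By the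
   Toeplitz-Hausdorff theorem the weighted sum is replaced by a single z with
   <Uz, Sz>_A = 0 and n(Uz) > M^2 n(z); since Sz is orthogonal to y = Uz, the pair
   (z, y), normalised, contradicts the definition of M.  Exact orthogonality
   matters: minimising over all x at once would only give <Uz, Sz>_A close to 0. *)
Require Import Defs.
From HB Require Import structures.
From mathcomp Require Import all_boot all_order all_algebra.
From mathcomp Require Import all_classical all_reals all_analysis.
From mathcomp Require Import complex.
From mathcomp Require Import ring lra.

Set Implicit Arguments.
Unset Strict Implicit.
Unset Printing Implicit Defensive.

Import Order.TTheory GRing.Theory Num.Theory.
Import numFieldNormedType.Exports.

Local Open Scope classical_set_scope.
Local Open Scope ring_scope.
Local Open Scope complex_scope.

Local Notation Re := complex.Re.
Local Notation Im := complex.Im.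

(** * Sesquilinear forms and a joint Toeplitz-Hausdorff theorem *)

Section sesquilinear_forms.
Context (R : realType) (V : lmodType R[i]).
Implicit Types (g n b h : V -> V -> R[i]) (x y z : V) (p q : R) (w : R[i]).

Lemma conjcM (a c : R[i]) : conjc (a * c) = conjc a * conjc c.
Proof. exact: rmorphM. Qed.

Lemma ReD (a c : R[i]) : Re (a + c) = Re a + Re c.
Proof. by case: a c => ? ? [? ?]. Qed.

Lemma ReN (a : R[i]) : Re (- a) = - Re a.
Proof. by case: a. Qed.

Lemma ReZ (u : R) (v : R[i]) : Re (u%:C * v) = u * Re v.
Proof. by case: v => v1 v2 /=; rewrite mul0r subr0. Qed.

(** Hermitian symmetry is left out so that the form sending [x], [y] to [f (U x) (S y)]
    qualifies. *)
Definition sesqform g : Prop :=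
  (forall a x y z, g (a *: x + y) z = a * g x z + g y z) /\
  (forall a x y z, g z (a *: x + y) = conjc a * g z x + g z y).

Lemma sesqformZl g a x z : sesqform g -> g (a *: x) z = a * g x z.
Proof.
move=> [gl _]; have e := gl 1 0 0 z; rewrite scale1r addr0 mul1r in e.
have -> : g (a *: x) z = a * g x z + g 0 z by rewrite -gl addr0.
suff -> : g 0 z = 0 by rewrite addr0.
by apply: (addrI (g 0 z)); rewrite -e addr0.
Qed.

Lemma sesqformZr g a x z : sesqform g -> g z (a *: x) = conjc a * g z x.
Proof.
move=> [_ gr]; have e := gr 1 0 0 z; rewrite scale1r addr0 conjc1 mul1r in e.
have -> : g z (a *: x) = conjc a * g z x + g z 0 by rewrite -gr addr0.
suff -> : g z 0 = 0 by rewrite addr0.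
by apply: (addrI (g z 0)); rewrite -e addr0.
Qed.

Lemma sesqform0 g : sesqform g -> g 0 0 = 0.
Proof. by move=> gs; rewrite -{1}(scale0r (0 : V)) sesqformZl // mul0r. Qed.

Lemma sesqformZ g a x : sesqform g -> g (a *: x) (a *: x) = a * conjc a * g x x.
Proof. by move=> gs; rewrite sesqformZl // sesqformZr // mulrA. Qed.

Lemma sesqformD g a c x y : sesqform g ->
  g (a *: x + c *: y) (a *: x + c *: y) =
  a * conjc a * g x x + c * conjc c * g y y + a * conjc c * g x y
  + c * conjc a * g y x.
Proof.
move=> gs; have [gl gr] := gs.
rewrite gl (sesqformZl _ _ _ gs) !gr !(sesqformZr _ _ _ gs); ring.
Qed.

(* Smallest eigenvalue of the Hermitian matrix [[p, w], [w^*, q]]. *)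
Definition hmin (p q : R) (w : R[i]) : R :=
  (p + q - Num.sqrt ((p - q) ^+ 2 + 4 * (Re w ^+ 2 + Im w ^+ 2))) / 2.

Lemma hmin_sqrt p q w :
  Num.sqrt ((p - q) ^+ 2 + 4 * (Re w ^+ 2 + Im w ^+ 2)) ^+ 2 =
  (p - q) ^+ 2 + 4 * (Re w ^+ 2 + Im w ^+ 2).
Proof.
apply: sqr_sqrtr; apply: addr_ge0; first exact: sqr_ge0.
by apply: mulr_ge0 => //; apply: addr_ge0; exact: sqr_ge0.
Qed.

(** [hmin] is a root of the characteristic polynomial, so subtracting it from the diagonal makes the
    matrix singular. *)
Lemma hmin_det p q w :
  (p - hmin p q w) * (q - hmin p q w) = Re w ^+ 2 + Im w ^+ 2.
Proof.
have := hmin_sqrt p q w; rewrite /hmin.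
set s := Num.sqrt _ => e.
have -> : (p - (p + q - s) / 2) * (q - (p + q - s) / 2)
  = (s ^+ 2 - (p - q) ^+ 2) / 4 by field.
by rewrite e; field.
Qed.

Lemma hmin_le p q w : hmin p q w <= p /\ hmin p q w <= q.
Proof.
have := hmin_sqrt p q w; rewrite /hmin.
set s := Num.sqrt _ => e.
have s0 : 0 <= s by exact: sqrtr_ge0.
have h : `|p - q| <= s.
  rewrite -(ler_pXn2r (_ : 0 < 2)%N) ?nnegrE // real_normK ?num_real // e.
  by rewrite lerDl; apply: mulr_ge0 => //; apply: addr_ge0; exact: sqr_ge0.
move: h; rewrite ler_norml => /andP[h1 h2]; split; lra.
Qed.

(** The smallest eigenvalues of a Hermitian matrix and of its opposite add up to [- s]; if neither
    is negative, [s] and the trace vanish, and with them the matrix. *)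
Lemma hmin_lt0 p q w : ~ [/\ p = 0, q = 0 & w = 0] ->
  hmin p q w < 0 \/ hmin (- p) (- q) (- w) < 0.
Proof.
move=> nz; have := hmin_sqrt p q w; rewrite /hmin.
have -> : Num.sqrt ((- p - - q) ^+ 2 + 4 * (Re (- w) ^+ 2 + Im (- w) ^+ 2)) =
  Num.sqrt ((p - q) ^+ 2 + 4 * (Re w ^+ 2 + Im w ^+ 2)).
  by congr Num.sqrt; rewrite !raddfN /=; ring.
set s := Num.sqrt _ => e.
have s0 : 0 <= s by exact: sqrtr_ge0.
case: (ltP ((p + q - s) / 2) 0) => [|h1]; first by left.
case: (ltP ((- p + - q - s) / 2) 0) => [|h2]; first by right.
have s00 : s = 0 by lra.
have pq : p + q = 0 by lra.
case: nz; move: e; rewrite s00 expr0n /=.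
have := sqr_ge0 (p - q); have := sqr_ge0 (Re w); have := sqr_ge0 (Im w) => i0 r0 d0 e.
have /eqP : (p - q) ^+ 2 = 0 by lra.
have /eqP : Re w ^+ 2 = 0 by lra.
have /eqP : Im w ^+ 2 = 0 by lra.
rewrite !sqrf_eq0 => /eqP iw /eqP rw /eqP d.
split; [lra|lra|].
by apply/eqP; rewrite eq_complex iw rw !eqxx.
Qed.

(** Factorisation of a singular positive semidefinite 2x2 matrix: for [p > 0], taking [a] as the
    square root of [p] determines [c]; for [p = 0] the determinant forces [w = 0]. *)
Lemma rank_one_factor (p q : R) (w : R[i]) : 0 <= p -> 0 <= q ->
  p * q = Re w ^+ 2 + Im w ^+ 2 ->
  exists a c : R[i], [/\ a * conjc a = p%:C, c * conjc c = q%:C & a * conjc c = w].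
Proof.
move=> p0 q0 e.
have [pe|pn] := eqVneq p 0.
  exists 0, (Num.sqrt q)%:C.
  have := sqr_ge0 (Re w); have := sqr_ge0 (Im w) => i0 r0.
  rewrite pe mul0r in e.
  have /eqP : Re w ^+ 2 = 0 by lra.
  have /eqP : Im w ^+ 2 = 0 by lra.
  rewrite !sqrf_eq0 => /eqP iw /eqP rw.
  split; first by rewrite pe mul0r.
    by rewrite conjc_real -rmorphM -expr2 sqr_sqrtr.
  by rewrite mul0r; apply/esym/eqP; rewrite eq_complex iw rw !eqxx.
have pp : 0 < p by rewrite lt_def pn.
have sn : (Num.sqrt p)%:C != 0 :> R[i].
  by rewrite (inj_eq (@complexI _)) // sqrtr_eq0 -ltNge.
have ss : (Num.sqrt p)%:C * (Num.sqrt p)%:C = p%:C :> R[i].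
  by rewrite -rmorphM -expr2 sqr_sqrtr.
exists (Num.sqrt p)%:C, (conjc w / (Num.sqrt p)%:C).
split; first by rewrite conjc_real ss.
  rewrite conjcM conjcK conjc_inv conjc_real.
  have -> : conjc w / (Num.sqrt p)%:C * (w / (Num.sqrt p)%:C) =
    (w * conjc w) / p%:C by rewrite -ss; field.
  have -> : w * conjc w = p%:C * q%:C.
    rewrite -rmorphM e; case: w {e} => u v; rewrite /=.
    by apply/eqP; rewrite eq_complex /=; apply/andP; split; apply/eqP; ring.
  by rewrite mulrC mulKf // (inj_eq (@complexI _)).
by rewrite conjcM conjcK conjc_inv conjc_real mulrC mulfVK.
Qed.

(** Trace pairing of a Hermitian matrix with the values of [g] on [x], [y]. The identity gives
    [g x x + g y y], and a positive matrix of rank one gives [g z z] for a combination [z] of [x]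
    and [y]. *)
Definition hpair (p q : R) (w : R[i]) g x y : R[i] :=
  p%:C * g x x + q%:C * g y y + w * g x y + conjc w * g y x.

(** Subtracting [hmin] times the identity leaves a positive matrix of rank at most one, whose factor
    supplies the coefficients of [z]; hence one [z] serves all forms at once. *)
Lemma hpair_rank_one p q w x y : exists z, forall g, sesqform g ->
  g z z = hpair p q w g x y - (hmin p q w)%:C * (g x x + g y y).
Proof.
have [hp hq] := hmin_le p q w.
have [||a [c [e1 e2 e3]]] := rank_one_factor _ _ (hmin_det p q w).
- by rewrite subr_ge0.
- by rewrite subr_ge0.
exists (a *: x + c *: y) => g gs.
have e4 : c * conjc a = conjc w by rewrite -e3 conjcM conjcK mulrC.
rewrite sesqformD // e1 e2 e3 e4 /hpair !rmorphB /=; ring.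
Qed.

Lemma hpairN p q w g x y :
  hpair (- p) (- q) (- w) g x y = - hpair p q w g x y.
Proof. rewrite /hpair !rmorphN /=; ring. Qed.

Lemma three_functionals (a b c : 'I_4 -> R) : exists2 k : 'I_4 -> R,
  exists i, k i != 0 &
  [/\ \sum_i k i * a i = 0, \sum_i k i * b i = 0 & \sum_i k i * c i = 0].
Proof.
pose M := \matrix_(i < 4, j < 3) [:: a i; b i; c i]`_j.
have : kermx M != 0.
  rewrite -mxrank_eq0 mxrank_ker -lt0n subn_gt0.
  exact: leq_ltn_trans (rank_leq_col M) _.
case/rowV0Pn => v /sub_kermxP vM v0.
exists (v 0).
  apply/existsP; apply: contraR v0; rewrite negb_exists => /forallP v0.
  by apply/eqP/rowP => i; rewrite mxE; apply/eqP; rewrite -[_ == _]negbK.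
have col j : \sum_i v 0 i * [:: a i; b i; c i]`_j = 0 :> R \/ (3 <= j)%N.
  case: (ltnP j 3) => jl; last by right.
  left; have := congr1 (fun N : 'rV_3 => N 0 (Ordinal jl)) vM; rewrite !mxE => e; rewrite -[RHS]e.
  by apply: eq_bigr => i _; rewrite mxE.
by split; [case: (col 0%N)|case: (col 1%N)|case: (col 2%N)].
Qed.

(** Hermitian 2x2 matrices form a real space of dimension four, and only three real equations are
    imposed, two of them by [b]. *)
Lemma hpair_kernel n b x y : exists p q w, [/\ ~ [/\ p = 0, q = 0 & w = 0],
  Re (hpair p q w n x y) = 0 & hpair p q w b x y = 0].
Proof.
(* Coefficients of [hpair] in the real coordinates [p], [q], [Re w], [Im w]. *)
pose F g (i : 'I_4) : R[i] := [:: g x x; g y y; g x y + g y x; 'i * (g x y - g y x)]`_i.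
have [k [i0 k0] [e1 e2 e3]] := three_functionals (fun i => Re (F n i))
  (fun i => Re (F b i)) (fun i => Im (F b i)).
pose k' j := k (inord j).
exists (k' 0%N), (k' 1%N), (k' 2%N +i* k' 3%N).
have E g : hpair (k' 0%N) (k' 1%N) (k' 2%N +i* k' 3%N) g x y =
    (\sum_i k i * Re (F g i)) +i* (\sum_i k i * Im (F g i)).
  rewrite !big_ord_recl !big_ord0 /F /hpair /k' /bump /=.
  have -> : inord 0 = ord0 :> 'I_4 by apply/val_inj; rewrite /= inordK.
  have -> : inord 1 = lift ord0 ord0 :> 'I_4 by apply/val_inj; rewrite /= inordK.
  have -> : inord 2 = lift ord0 (lift ord0 ord0) :> 'I_4 by apply/val_inj; rewrite /= inordK.
  have -> : inord 3 = lift ord0 (lift ord0 (lift ord0 ord0)) :> 'I_4 by apply/val_inj; rewrite /= inordK.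
  case: (g x x) (g y y) (g x y) (g y x) => [? ?] [? ?] [? ?] [? ?].
  by apply/eqP; rewrite eq_complex /=; apply/andP; split; apply/eqP; ring.
split; last 2 first.
- by rewrite E.
- by rewrite E e2 e3.
case=> a0 a1 [a2 a3]; move/eqP: k0; apply.
have -> : i0 = inord i0 by apply/val_inj; rewrite /= inordK.
by case: i0 => -[|[|[|[|]]]].
Qed.

(* Toeplitz-Hausdorff: moving from the identity matrix along a Hermitian
   direction on which [n] and [b] vanish and [h] is nonnegative, one reaches the
   boundary of the positive semidefinite 2x2 matrices, i.e. a matrix of rank
   one.  The bound [h <= c n] handles directions that are semidefinite. *)
Lemma sesqform_convex n b h (c : R) x y :
  sesqform n -> sesqform b -> sesqform h ->
  0 <= c -> (forall z, 0 <= Re (n z z)) ->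
  (forall z, Re (h z z) <= c * Re (n z z)) ->
  exists z, [/\ Re (n z z) = Re (n x x) + Re (n y y), b z z = b x x + b y y &
    Re (h x x) + Re (h y y) <= Re (h z z)].
Proof.
move=> sn sb sh c0 n0 hn.
set goal := (exists z, _).
have step p q w : hmin p q w < 0 -> Re (hpair p q w n x y) = 0 ->
    hpair p q w b x y = 0 -> 0 <= Re (hpair p q w h x y) ->
  goal.
  move=> l0 en eb eh; have [z hz] := hpair_rank_one p q w x y.
  pose r := - (hmin p q w)^-1.
  have r0 : 0 < r by rewrite /r oppr_gt0 invr_lt0.
  (* After scaling by [r], the matrix behind [z] is the identity plus [r] times the chosen
     direction. *)
  exists ((Num.sqrt r)%:C *: z).
  have E g : sesqform g -> g ((Num.sqrt r)%:C *: z) ((Num.sqrt r)%:C *: z) =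
      r%:C * hpair p q w g x y + (g x x + g y y).
    move=> sg; rewrite sesqformZ // conjc_real -rmorphM -expr2 sqr_sqrtr ?ltW //.
    rewrite hz // mulrBr mulrA -rmorphM /= {2}/r mulNr mulVf ?lt_eqF //.
    by rewrite rmorphN1; ring.
  split.
  - by rewrite E // !ReD ReZ en mulr0 add0r.
  - by rewrite E // eb mulr0 add0r.
  - by rewrite E // !ReD ReZ lerDr mulr_ge0 // ltW.
have [p [q [w [nz en eb]]]] := hpair_kernel n b x y.
have step2 p' q' w' : ~ [/\ p' = 0, q' = 0 & w' = 0] -> Re (hpair p' q' w' n x y) = 0 ->
    hpair p' q' w' b x y = 0 -> 0 <= Re (hpair p' q' w' h x y) ->
  goal.
  move=> {p q w nz en eb}; move: p' q' w' => p q w nz en eb eh.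
  case: (ltP (hmin p q w) 0) => [l0|l0]; first exact: (step p q w).
  case: (hmin_lt0 nz) => [|l1]; first by rewrite ltNge l0.
  apply: (step _ _ _ l1); rewrite hpairN ?ReN; [by rewrite en oppr0|by rewrite eb oppr0|].
  (* With [hmin] nonnegative the direction is reversed. The bound [h <= c n] at [z], [x] and [y]
     shows that [h] is at most 0 along the original direction, hence nonnegative along the reversed
     one. *)
  have [z hz] := hpair_rank_one p q w x y.
  have := hn z; rewrite (hz n sn) (hz h sh).
  move: (hpair p q w n x y) en (hpair p q w h x y) eh => kn en kh eh.
  rewrite !ReD !ReN !ReZ !ReD en.
  have := hn x; have := hn y.
  move: (hmin p q w) l0 (Re kh) eh => l l0 k eh.
  move: (Re (n x x)) (Re (n y y)) (Re (h x x)) (Re (h y y)) => nx ny hx hy hy1 hx1.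
  have le0 : 0 <= c * nx + c * ny - hx - hy by lra.
  have := mulr_ge0 l0 le0; nra.
case: (leP 0 (Re (hpair p q w h x y))) => eh; first exact: (step2 p q w).
apply: (step2 (- p) (- q) (- w)).
- by case=> /eqP + /eqP + /eqP; rewrite !oppr_eq0 => /eqP ? /eqP ? /eqP ?; apply: nz.
- by rewrite hpairN ReN en oppr0.
- by rewrite hpairN eb oppr0.
- by rewrite hpairN ReN oppr_ge0 ltW.
Qed.

Lemma sesqform_convex_sum n b h (c : R) (s : seq V) :
  sesqform n -> sesqform b -> sesqform h ->
  0 <= c -> (forall z, 0 <= Re (n z z)) ->
  (forall z, Re (h z z) <= c * Re (n z z)) ->
  exists z, [/\ Re (n z z) = \sum_(x <- s) Re (n x x),
    b z z = \sum_(x <- s) b x x & \sum_(x <- s) Re (h x x) <= Re (h z z)].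
Proof.
move=> sn sb sh c0 n0 hn; elim: s => [|x s [z [e1 e2 e3]]].
  by exists 0; rewrite !big_nil !sesqform0.
have [t [f1 f2 f3]] := sesqform_convex x z sn sb sh c0 n0 hn.
exists t; rewrite !big_cons -e1 -e2 f1 f2; split=> //.
by apply: le_trans f3; rewrite lerD2l.
Qed.

End sesquilinear_forms.

(* [compact_cover] requires a pointed space. *)
HB.instance Definition _ (T1 T2 : ptopologicalType) := Pointed.on (T1 * T2)%type.

(** * Quadratic functions on the real plane: minimisation and compactness *)

Section real_quadratics.
Context (R : realType).
Implicit Types (A r i s : R).

(** The value n(u + g v) in the coordinates of [g = t.1 +i* t.2], where [A] is n(u), [r +i* i] is
    the product of [u] and [v], and [s] is n(v); a constant to be subtracted is absorbed into
    [A]. *)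
Definition quad A r i s (t : R * R) : R :=
  A + 2 * (t.1 * r + t.2 * i) + (t.1 ^+ 2 + t.2 ^+ 2) * s.

Lemma continuous_quad A r i s : continuous (quad A r i s).
Proof.
move=> t; rewrite /quad.
have c1 : (fun t : R * R => t.1) x @[x --> t] --> t.1 by exact: cvg_fst.
have c2 : (fun t : R * R => t.2) x @[x --> t] --> t.2 by exact: cvg_snd.
apply: cvgD; first apply: cvgD; first exact: cvg_cst.
- apply: cvgM; first exact: cvg_cst.
  by apply: cvgD; apply: cvgM => //; exact: cvg_cst.
- apply: cvgM; last exact: cvg_cst.
  by apply: cvgD; rewrite !expr2; apply: cvgM.
Qed.

Lemma quad_bounded A r i s (L : R) : 0 < s -> exists k : R, forall t,
  quad A r i s t <= L -> (`[- k, k] `*` `[- k, k])%classic t.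
Proof.
move=> s0; pose D := (L - A + (r ^+ 2 + i ^+ 2) / s) / s.
(* Completing the square gives a disc with centre [(- r / s, - i / s)] and squared radius [D]; a
   square root is at most its argument plus one. *)
exists (`|r / s| + `|i / s| + `|D| + 1) => -[a b].
rewrite /quad /= => le.
have sn : s != 0 by rewrite gt_eqF.
have E : (a + r / s) ^+ 2 + (b + i / s) ^+ 2 <= D.
  rewrite /D ler_pdivlMr //.
  have -> : ((a + r / s) ^+ 2 + (b + i / s) ^+ 2) * s =
    (A + 2 * (a * r + b * i) + (a ^+ 2 + b ^+ 2) * s) - A + (r ^+ 2 + i ^+ 2) / s by field.
  lra.
have [r1 r2] : - `|r / s| <= r / s <= `|r / s| /\ - `|i / s| <= i / s <= `|i / s|.
  by split; rewrite -ler_norml.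
have d1 := ler_norm D.
move: (r / s) (i / s) `|r / s| `|i / s| (normr_ge0 (r / s)) (normr_ge0 (i / s))
  r1 r2 D `|D| E d1 => u v ru rv ru0 rv0 /andP[r1 r1'] /andP[r2 r2'] D0 d E d1.
have := sqr_ge0 (a + u); have := sqr_ge0 (b + v) => q1 q2.
split; rewrite /= in_itv /=; apply/andP; split; nra.
Qed.

Definition excess A r i s t : R := Num.max 0 (quad A r i s t).

Lemma continuous_excess A r i s : continuous (excess A r i s).
Proof.
move=> t; apply: (@continuous_max _ _ (cst 0) (quad A r i s)).
- exact: cvg_cst.
- exact: continuous_quad.
Qed.

(* [max 0] squared lies below its second-order expansion, so the first-order
   condition at a minimiser can be read off without differentiating. *)
Lemma sqr_max0_le (u e : R) :
  Num.max 0 (u + e) ^+ 2 <= Num.max 0 u ^+ 2 + 2 * Num.max 0 u * e + e ^+ 2.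
Proof. by rewrite /Num.max; case: ltP => ?; case: ltP => ?; nra. Qed.

(** The two sums are a quarter of the partial derivatives of [G], the sum of the squared excesses.
    The term of [j0] is coercive, so [G] has a minimiser. *)
Lemma excess_minimiser (I : eqType) (l : seq I) (A r i s : I -> R) (j0 : I) :
  j0 \in l -> 0 < s j0 -> (forall j, 0 <= s j) ->
  exists t : R * R,
    \sum_(j <- l) excess (A j) (r j) (i j) (s j) t * (r j + t.1 * s j) = 0 /\
    \sum_(j <- l) excess (A j) (r j) (i j) (s j) t * (i j + t.2 * s j) = 0.
Proof.
move=> jl sj0 s0; pose G t := \sum_(j <- l) excess (A j) (r j) (i j) (s j) t ^+ 2.
have Gc : continuous G.
  rewrite /G; elim: (l) => [|j l' IH] t.
    by under eq_fun do rewrite big_nil; exact: cvg_cst.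
  under eq_fun do rewrite big_cons.
  apply: cvgD; last exact: IH.
  by rewrite expr2; apply: cvgM; exact: continuous_excess.
have Gj t : excess (A j0) (r j0) (i j0) (s j0) t ^+ 2 <= G t.
  rewrite /G; elim: (l) jl => [//|j l' IH]; rewrite inE big_cons => /orP[/eqP ->|/IH h].
    by rewrite lerDl sumr_ge0 // => *; exact: sqr_ge0.
  by apply: le_trans h _; rewrite lerDr sqr_ge0.
(* Everywhere [quad] is at most 1 plus the squared excess, so this box contains the sublevel set of
   [G] at level [G (0, 0)], and a minimum over the box is global. *)
have [k kP] := quad_bounded (A j0) (r j0) (i j0) (1 + G (0, 0)) sj0.
have G0 : 0 <= G (0, 0) by apply: sumr_ge0 => *; exact: sqr_ge0.
pose K := (`[- k, k] `*` `[- k, k])%classic : set (R * R).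
have lowK t : G t <= G (0, 0) -> K t.
  move=> le; apply: kP; have := le_trans (Gj t) le.
  by rewrite /excess /Num.max; case: ltP => ?; nra.
have [|||t tK tmin] := @compact_EVT_min _ _ G K.
- by exists (0, 0); exact: lowK.
- by apply: compact_setX; exact: segment_compact.
- exact: continuous_subspaceT.
have tm u : G t <= G u.
  case: (lerP (G u) (G (0, 0))) => h; first by apply: tmin; rewrite inE; exact: lowK.
  by apply: le_trans (ltW h); apply: tmin; rewrite inE; exact: lowK.
exists t.
suff le0 W1 W2 :
    W1 = \sum_(j <- l) excess (A j) (r j) (i j) (s j) t * (r j + t.1 * s j) ->
    W2 = \sum_(j <- l) excess (A j) (r j) (i j) (s j) t * (i j + t.2 * s j) ->
    W1 ^+ 2 + W2 ^+ 2 <= 0.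
  have := le0 _ _ erefl erefl; move: (\sum_(j <- l) _) (\sum_(j <- l) _) => W1 W2.
  have := sqr_ge0 W1; have := sqr_ge0 W2 => w2 w1 w.
  have /eqP : W1 ^+ 2 = 0 by lra.
  have /eqP : W2 ^+ 2 = 0 by lra.
  by rewrite !sqrf_eq0 => /eqP -> /eqP ->.
move=> E1 E2; pose N := W1 ^+ 2 + W2 ^+ 2; rewrite -/N.
pose w j := excess (A j) (r j) (i j) (s j) t.
pose c j := W1 * (r j + t.1 * s j) + W2 * (i j + t.2 * s j).
have sumwc : \sum_(j <- l) w j * c j = N.
  rewrite /N !expr2 {2}E1 {2}E2 !mulr_sumr -big_split; apply: eq_bigr => j _.
  by rewrite /c /w /= mulrDr; congr (_ + _); rewrite mulrCA.
have N0 : 0 <= N by rewrite addr_ge0 // sqr_ge0.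
(* For [0 < e <= 1], [e ^+ 2 * Q j] dominates the terms beyond first order when [t] moves by [- e]
   times [(W1, W2)]. *)
pose Q j := 2 * N * (w j * s j) + 8 * c j ^+ 2 + 2 * N ^+ 2 * s j ^+ 2.
have w0 j : 0 <= w j by rewrite /w /excess le_max lexx.
have Q0 : 0 <= \sum_(j <- l) Q j.
  apply: sumr_ge0 => j _; rewrite /Q.
  have p2 : 0 <= 2 :> R by [].
  have p8 : 0 <= 8 :> R by [].
  exact: addr_ge0 (addr_ge0 (mulr_ge0 (mulr_ge0 p2 N0) (mulr_ge0 (w0 j) (s0 j)))
    (mulr_ge0 p8 (sqr_ge0 _))) (mulr_ge0 (mulr_ge0 p2 (sqr_ge0 _)) (sqr_ge0 _)).
(* A step of size [e] against the gradient cannot lower [G], yet it loses [4 * e * N] and regains at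
   most [e ^+ 2] times the sum of the [Q j]. *)
have key (e : R) : 0 < e -> e <= 1 -> 4 * N <= e * \sum_(j <- l) Q j.
  move=> e0 e1.
  have := tm (t.1 - e * W1, t.2 - e * W2).
  have le : G (t.1 - e * W1, t.2 - e * W2) <=
      \sum_(j <- l) (w j ^+ 2 + (- 4 * e) * (w j * c j) + e ^+ 2 * Q j).
    apply: ler_sum => j _; rewrite {1}/excess.
    pose d := e * (- 2 * c j + e * N * s j).
    have -> : quad (A j) (r j) (i j) (s j) (t.1 - e * W1, t.2 - e * W2) =
        quad (A j) (r j) (i j) (s j) t + d.
      by rewrite /quad /d /c /N /=; ring.
    apply: le_trans (sqr_max0_le _ _) _.
    rewrite -/(excess (A j) (r j) (i j) (s j) t) -/(w j) /Q -subr_ge0.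
    have -> : w j ^+ 2 + (- 4 * e) * (w j * c j) +
        e ^+ 2 * (2 * N * (w j * s j) + 8 * c j ^+ 2 + 2 * N ^+ 2 * s j ^+ 2) -
        (w j ^+ 2 + 2 * w j * d + d ^+ 2) =
        e ^+ 2 * ((2 * c j + e * N * s j) ^+ 2 + 2 * (1 - e ^+ 2) * (N * s j) ^+ 2).
      by rewrite /d; ring.
    apply: mulr_ge0; first exact: sqr_ge0.
    apply: addr_ge0; first exact: sqr_ge0.
    apply: mulr_ge0; last exact: sqr_ge0.
    by apply: mulr_ge0 => //; rewrite subr_ge0; nra.
  have sumE : \sum_(j <- l) (w j ^+ 2 + (- 4 * e) * (w j * c j) + e ^+ 2 * Q j) =
      G t + - 4 * e * N + e ^+ 2 * \sum_(j <- l) Q j.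
    by rewrite 2!big_split /= -!mulr_sumr sumwc.
  move=> /le_trans /(_ le); rewrite sumE.
  move: (\sum_(j <- l) Q j) (G t) => q g h.
  have h' : 0 <= e * (e * q - 4 * N) by lra.
  by move: h'; rewrite pmulr_rge0 // subr_ge0.
rewrite leNgt; apply/negP => Np.
move: (\sum_(j <- l) Q j) Q0 key => q q0 key.
have qN : 0 < q + N by lra.
(* This [e] is admissible even when [q = 0], and it would give [4 * (q + N) <= q]. *)
have := key (N / (q + N)); rewrite divr_gt0 // ler_pdivrMr // mul1r lerDr => /(_ isT q0).
by rewrite mulrAC ler_pdivlMr //; nra.
Qed.
(** Without a common point, the open sets where some [quad] is positive cover a compact box around
    the disc of [j0], and a finite subcover contradicts the hypothesis on lists. *)
Lemma quad_le0_inter (I : choiceType) (A r i s : I -> R) (j0 : I) : 0 < s j0 ->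
  (forall l : seq I, exists t, forall j, j \in l -> quad (A j) (r j) (i j) (s j) t <= 0) ->
  exists t, forall j, quad (A j) (r j) (i j) (s j) t <= 0.
Proof.
move=> sj0 fin; apply: contrapT => /forallNP none.
have [k kP] := quad_bounded (A j0) (r j0) (i j0) 0 sj0.
pose K := (`[- k, k] `*` `[- k, k])%classic : set (R * R).
have : compact K by apply: compact_setX; exact: segment_compact.
rewrite (@compact_cover (R * R)%type) => /(_ I setT
  (fun j => [set t | 0 < quad (A j) (r j) (i j) (s j) t])) [].
- move=> j _; apply: (open_comp (f := quad (A j) (r j) (i j) (s j)) (D := [set u | 0 < u])).
    by move=> t _; exact: continuous_quad.
  exact: open_gt.
- move=> t _; have /existsNP [j /negP] := none t.
  by rewrite -ltNge => jt; exists j.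
(* Adding [j0] to the list forces [t] into the box, where the cover applies. *)
move=> D _ cov; have [t tl] := fin (j0 :: finmap.enum_fset D).
have [|j /= jD] := cov t; first by apply: kP; apply: tl; rewrite inE eqxx.
by rewrite ltNge tl // inE jD orbT.
Qed.

End real_quadratics.

(** * Semi-inner products, possibly degenerate *)

Section semi_inner_product.
Context (R : realType) (V : lmodType R[i]) (f : V -> V -> R[i]).
Hypothesis fs : sesqform f.
Hypothesis fh : forall x y, f y x = conjc (f x y).
Hypothesis fp : forall x, 0 <= f x x.
Implicit Types (x y : V).

Definition sqn x : R := Re (f x x).

Lemma form_sqn x : f x x = (sqn x)%:C.
Proof.
rewrite /sqn; have := fp x; case: (f x x) => u v.
by rewrite lecE /= => /andP[/eqP -> _].
Qed.

Lemma sqn_ge0 x : 0 <= sqn x.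
Proof. by have := fp x; rewrite form_sqn ler0c. Qed.

Lemma sqnD (a c : R[i]) x y : sqn (a *: x + c *: y) =
  (Re a ^+ 2 + Im a ^+ 2) * sqn x + (Re c ^+ 2 + Im c ^+ 2) * sqn y
  + 2 * Re (a * conjc c * f x y).
Proof.
rewrite {1}/sqn (sesqformD _ _ _ _ fs) !form_sqn (fh x y).
by case: a c (f x y) => [? ?] [? ?] [? ?] /=; ring.
Qed.

Lemma sqnDZ (c : R[i]) x y : sqn (x + c *: y) =
  sqn x + (Re c ^+ 2 + Im c ^+ 2) * sqn y + 2 * Re (conjc c * f x y).
Proof.
rewrite -{1}[x]scale1r sqnD mul1r.
by rewrite -[Re 1]/(1 : R) -[Im 1]/(0 : R) expr1n expr0n addr0 mul1r.
Qed.

Lemma sqnDD x y : sqn (x + y) = sqn x + sqn y + 2 * Re (f x y).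
Proof.
rewrite -{1}[y]scale1r sqnDZ conjc1 mul1r.
by rewrite -[Re 1]/(1 : R) -[Im 1]/(0 : R) expr1n expr0n addr0 mul1r.
Qed.

Lemma sqnZ (a : R[i]) x : sqn (a *: x) = (Re a ^+ 2 + Im a ^+ 2) * sqn x.
Proof.
by rewrite {1}/sqn (sesqformZ _ _ fs) form_sqn; case: a => u v /=; ring.
Qed.

Lemma cauchy_schwarz x y :
  Re (f x y) ^+ 2 + Im (f x y) ^+ 2 <= sqn x * sqn y.
Proof.
(* If [sqn y > 0], the choice [u = sqn y], [t = 1] suffices. If [sqn y = 0], the expression is
   affine in [t], and a large [t] excludes a nonzero [f x y]. *)
have h (u t : R) : 0 <= u ^+ 2 * sqn x + t ^+ 2 *
    (Re (f x y) ^+ 2 + Im (f x y) ^+ 2) * sqn y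
    - 2 * u * t * (Re (f x y) ^+ 2 + Im (f x y) ^+ 2).
  have := sqn_ge0 (u%:C *: x + (- t%:C * f x y) *: y); rewrite sqnD.
  by case: (f x y) => v w /=; congr (_ <= _); ring.
move: (_ + _) h (addr_ge0 (sqr_ge0 (Re (f x y))) (sqr_ge0 (Im (f x y)))) => m h m0.
have [y0|yn] := eqVneq (sqn y) 0.
  have [->|mn] := eqVneq m 0; first by rewrite mulr_ge0 // sqn_ge0.
  have mp : 0 < m by rewrite lt_def mn.
  have := h 1 ((sqn x + 1) / m); rewrite y0 mulr0 addr0 expr1n mul1r mulr1.
  by rewrite -mulrA divfK //; have := sqn_ge0 x => *; lra.
have yp : 0 < sqn y by rewrite lt_def yn sqn_ge0.
have := h (sqn y) 1; rewrite expr1n mul1r mulr1.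
have -> : sqn y ^+ 2 * sqn x + m * sqn y - 2 * sqn y * m =
  sqn y * (sqn x * sqn y - m) by ring.
by rewrite pmulr_rge0 // subr_ge0.
Qed.

Lemma form_eq0 x y : sqn x * sqn y = 0 -> f x y = 0.
Proof.
move=> e; have := cauchy_schwarz x y; rewrite e.
have := sqr_ge0 (Re (f x y)); have := sqr_ge0 (Im (f x y)) => i0 r0 le.
have /eqP : Re (f x y) ^+ 2 = 0 by lra.
have /eqP : Im (f x y) ^+ 2 = 0 by lra.
rewrite !sqrf_eq0 => /eqP iw /eqP rw.
by apply/eqP; rewrite eq_complex iw rw !eqxx.
Qed.

Lemma sesqform_comp (U W : {linear V -> V}) : sesqform (fun x y => f (U x) (W y)).
Proof.
by case: fs => fl fr; split=> a x y z; rewrite linearP ?fl ?fr.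
Qed.

(** * The pencil [T + g S]: one [g] for all vectors *)

Section pencil.
Context (T S : {linear V -> V}) (cT cS M : R).
Hypothesis cT0 : 0 <= cT.
Hypothesis Tb : forall x, sqn (T x) <= cT * sqn x.
Hypothesis cS0 : 0 <= cS.
Hypothesis Sb : forall x, sqn (S x) <= cS * sqn x.
Hypothesis hyp : forall g x, f (T x + g *: S x) (S x) = 0 ->
  sqn (T x + g *: S x) <= M * sqn x.

Let A x : R := sqn (T x) - M * sqn x.
Let r x : R := Re (f (T x) (S x)).
Let i x : R := Im (f (T x) (S x)).
Let s x : R := sqn (S x).

Lemma pencil_quad (t : R * R) x :
  quad (A x) (r x) (i x) (s x) t =
  sqn (T x + (t.1 +i* t.2) *: S x) - M * sqn x.
Proof.
rewrite /quad -[T x in RHS]scale1r sqnD /A /r /i /s.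
by case: (f (T x) (S x)) t => [? ?] [? ?] /=; ring.
Qed.

Lemma pencil_finite (x0 : V) (l : seq V) : 0 < sqn (S x0) -> exists t, forall x,
  x \in l -> quad (A x) (r x) (i x) (s x) t <= 0.
Proof.
move=> Sx0; have s0 x : 0 <= s x by exact: sqn_ge0.
have [t [t1 t2]] := excess_minimiser A r i (mem_head x0 l) Sx0 s0.
exists t => x xl; rewrite leNgt; apply/negP => qx.
pose g := t.1 +i* t.2.
pose w x := excess (A x) (r x) (i x) (s x) t.
have w0 z : 0 <= w z by rewrite /w /excess le_max lexx.
pose U : {linear V -> V} := T \+ (g \*: S).
have Us z : f (U z) (S z) = (r z + t.1 * s z) +i* (i z + t.2 * s z).
  case: fs => fl _; rewrite /U /= addrC fl form_sqn /r /i /s /g.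
  by case: (f (T z) (S z)) => u v /=; apply/eqP; rewrite eq_complex /=;
    apply/andP; split; apply/eqP; ring.
(* The constant comes from n(a + b) <= 2 n(a) + 2 n(b). *)
have c0 : 0 <= 2 * cT + 2 * (t.1 ^+ 2 + t.2 ^+ 2) * cS.
  apply: addr_ge0; apply: mulr_ge0 => //; apply: mulr_ge0 => //.
  by apply: addr_ge0; exact: sqr_ge0.
have Ub z : sqn (U z) <= (2 * cT + 2 * (t.1 ^+ 2 + t.2 ^+ 2) * cS) * sqn z.
  have e1 : sqn (U z) = sqn (T z) + (t.1 ^+ 2 + t.2 ^+ 2) * sqn (S z)
      + 2 * Re (conjc g * f (T z) (S z)).
    by rewrite /U /= -[T z in LHS]scale1r sqnD /= expr1n expr0n addr0 !mul1r.
  have e2 : 0 <= sqn (T z) + (t.1 ^+ 2 + t.2 ^+ 2) * sqn (S z)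
      - 2 * Re (conjc g * f (T z) (S z)).
    have := sqn_ge0 (1 *: T z + (- g) *: S z); rewrite sqnD.
    by case: (f (T z) (S z)) => u v /=; congr (_ <= _); ring.
  have q0 : 0 <= t.1 ^+ 2 + t.2 ^+ 2 by rewrite addr_ge0 // sqr_ge0.
  have := Tb z; have := ler_wpM2l q0 (Sb z); rewrite e1; lra.
(* Scaling each vector by the square root of its excess turns plain sums of form values into the
   weighted ones. *)
have [z [z1 z2 z3]] := sesqform_convex_sum
  [seq (Num.sqrt (w x))%:C *: x | x <- x0 :: l] fs (sesqform_comp U S)
  (sesqform_comp U U) c0 sqn_ge0 Ub.
have sq y : (Num.sqrt (w y))%:C * conjc (Num.sqrt (w y))%:C = (w y)%:C :> R[i].
  by rewrite conjc_real -rmorphM -expr2 sqr_sqrtr.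
have Sz0 : f (T z + g *: S z) (S z) = 0.
  rewrite -[LHS]/(f (U z) (S z)) z2 big_map.
  under eq_bigr => y _ do rewrite (sesqformZ _ _ (sesqform_comp U S)) sq Us.
  have E (m : seq V) : \sum_(y <- m) (w y)%:C * ((r y + t.1 * s y) +i* (i y + t.2 * s y))
     = (\sum_(y <- m) w y * (r y + t.1 * s y)) +i* (\sum_(y <- m) w y * (i y + t.2 * s y)).
    elim: m => [|y m IH]; first by rewrite !big_nil.
    rewrite !big_cons IH; apply/eqP; rewrite eq_complex /=.
    by rewrite !mul0r subr0 addr0 !eqxx.
  by rewrite E t1 t2.
have := hyp Sz0; rewrite -[sqn (T z + _)]/(Re (f (U z) (U z))) => le.
have := le_trans z3 le; rewrite -[sqn z]/(Re (f z z)) z1 !big_map.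
under eq_bigr => y _ do rewrite (sesqformZ _ _ (sesqform_comp U U)) sq ReZ.
under [X in _ <= _ * X -> _]eq_bigr => y _ do rewrite (sesqformZ _ _ fs) sq ReZ.
rewrite mulr_sumr -subr_le0 -sumrB leNgt => /negP; apply.
(* Each term is a squared excess, and that of [x] is positive, although [hyp] at [z] makes the sum
   at most 0. *)
have term y : w y * Re (f (U y) (U y)) - M * (w y * Re (f y y)) =
  w y * quad (A y) (r y) (i y) (s y) t.
  rewrite pencil_quad /U /sqn /= -/g; ring.
under eq_bigr do rewrite term.
have nn y : 0 <= w y * quad (A y) (r y) (i y) (s y) t.
  by rewrite /w /excess /Num.max; case: ltP => h; rewrite ?mul0r // -expr2 sqr_ge0.
have pos : 0 < w x * quad (A x) (r x) (i x) (s x) t.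
  by rewrite /w /excess /Num.max qx mulr_gt0.
rewrite (big_rem x) /=; last by rewrite inE xl orbT.
by rewrite ltr_wpDr // sumr_ge0.
Qed.

Lemma pencil_bound : exists g : R[i], forall x, sqn (T x + g *: S x) <= M * sqn x.
Proof.
have [[x0 x0p]|none] := pselect (exists x0, 0 < sqn (S x0)).
  have [t tP] := quad_le0_inter (A := A) (r := r) (i := i) (s := s) x0p (fun l => pencil_finite l x0p).
  exists (t.1 +i* t.2) => x.
  by have := tP x; rewrite pencil_quad subr_le0.
(* Every [S x] is null here, so by Cauchy-Schwarz the orthogonality in [hyp] is automatic. *)
exists 0 => x; apply: hyp; apply: form_eq0; rewrite mulrC.
suff -> : sqn (S x) = 0 by rewrite mul0r.
apply/eqP; rewrite eq_le sqn_ge0 andbT leNgt; apply/negP => h.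
by apply: none; exists x.
Qed.

End pencil.
End semi_inner_product.

(** * The form of [A] and the density of its range for the seminorm *)

Section A_seminorm.
Context (R : realType) (H : completeNormedModType R[i]).
Context (dot : {dot H for (@Num.conj R[i])}).
Hypothesis dot_norm : induces_norm dot.
Context (A : {linear H -> H}).
Hypothesis A_bnd : bounded_near A (nbhs (0 : H)).
Hypothesis A_pos : positive_op dot A.

Let f := dotA dot A.

Lemma dot_sesqform : sesqform dot.
Proof.
split=> a x y z; first by rewrite linearPl.
by rewrite linearPr.
Qed.

Lemma dot_hermitian x y : dot y x = conjc (dot x y).
Proof. by rewrite hermC /= expr0 mul1r. Qed.

Lemma dot_ge0 x : 0 <= dot x x.
Proof. by rewrite -dot_norm exprn_ge0. Qed.

Lemma dotA_sesqform : sesqform f.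
Proof.
have [dl dr] := dot_sesqform.
by split=> a x y z; rewrite /f /dotA ?linearP ?dl ?dr.
Qed.

(* Polarization of the real values [f z z]. *)
Lemma dotA_hermitian x y : f y x = conjc (f x y).
Proof.
have im0 z : Im (f z z) = 0.
  by have := A_pos z; rewrite lecE /= => /andP[/eqP ->].
have := im0 (1 *: x + 1 *: y); have := im0 (1 *: x + 'i *: y).
rewrite !(sesqformD _ _ _ _ dotA_sesqform).
move: (im0 x) (im0 y).
case: (f x x) (f y y) (f x y) (f y x) => [? ?] [? ?] [u v] [u' v'] /= -> -> e1 e2.
by apply/eqP; rewrite eq_complex /=; apply/andP; split; apply/eqP; lra.
Qed.

Lemma dotA_ge0 x : 0 <= f x x. Proof. exact: A_pos. Qed.

Local Notation n := (sqn f).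
Local Notation N := (sqn dot).

Lemma seminormA_sqr x : seminormA dot A x ^+ 2 = n x.
Proof. by rewrite sqr_sqrtr //; exact: sqn_ge0 dotA_ge0 x. Qed.

Lemma normr_sqn x : `|x| ^+ 2 = (N x)%:C.
Proof. by rewrite dot_norm (form_sqn dot_ge0). Qed.

Lemma A_sqn_bounded : exists2 c : R, 0 < c & forall x, N (A x) <= c ^+ 2 * N x.
Proof.
have /linear_boundedP [m [/complex_realP [k ->] kP]] := A_bnd.
(* The bound holds only for constants strictly above [k], and [k] may be negative. *)
exists (`|k| + 1); first by rewrite ltr_wpDl.
move=> x; have := kP (`|k| + 1)%:C; rewrite ltcR ltr_pwDr ?ler_norm // => /(_ isT x).
rewrite -(ler_pXn2r (_ : 0 < 2)%N) ?nnegrE ?mulr_ge0 ?ler0c ?addr_ge0 //.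
by rewrite exprMn !normr_sqn -rmorphXn -rmorphM lecR.
Qed.

Let fs := dotA_sesqform.
Let fh := dotA_hermitian.
Let fp := dotA_ge0.
Let n_ge0 := sqn_ge0 fp.
Let N_ge0 := sqn_ge0 dot_ge0.

(* Gradient descent [e <- e - (A e) / c] stays in the coset [x + range A], and
   each step lowers [`|e|^2] by at least [<A e, e> / c]. *)
Lemma range_dense x (d : R) : 0 < d -> exists w, n (x - A w) <= d.
Proof.
move=> d0; apply: contrapT => /forallNP far.
have [c c0 Ac] := A_sqn_bounded.
have nN y : n y <= c * N y.
  have := cauchy_schwarz dot_sesqform dot_hermitian dot_ge0 (A y) y.
  rewrite -[Re (dot (A y) y)]/(n y) => h.
  have : n y ^+ 2 <= (c * N y) ^+ 2.
    have := sqr_ge0 (Im (dot (A y) y)); have := ler_wpM2r (N_ge0 y) (Ac y).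
    by rewrite exprMn -mulrA -expr2; lra.
  by rewrite ler_pXn2r // nnegrE ?n_ge0 // mulr_ge0 ?N_ge0 // ltW.
(* Since [f y (A y)] is [N (A y)], Cauchy-Schwarz for [f] bounds the square of [N (A y)] by
   [n y * n (A y)], and a factor [N (A y)] cancels against [nN]. *)
have NA y : N (A y) <= c * n y.
  have [->|nz] := eqVneq (N (A y)) 0; first by rewrite mulr_ge0 ?n_ge0 // ltW.
  have p : 0 < N (A y) by rewrite lt_def nz N_ge0.
  have := cauchy_schwarz fs fh fp y (A y).
  rewrite -[Re (f y (A y))]/(N (A y)) => h.
  have := ler_wpM2l (n_ge0 y) (nN (A y)); have := sqr_ge0 (Im (f y (A y))).
  by move=> ? ?; rewrite -(ler_pM2r p); lra.
have descent y : N (y + (- c^-1)%:C *: A y) <= N y - c^-1 * n y.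
  have -> : N (y + (- c^-1)%:C *: A y) = N y + c^-1 ^+ 2 * N (A y) - 2 * (c^-1 * n y).
    rewrite (sqnDZ dot_sesqform dot_hermitian dot_ge0) conjc_real dot_hermitian.
    rewrite -[dot (A y) y]/(f y y) (form_sqn fp) conjc_real ReZ.
    by rewrite /= expr0n addr0 sqrrN mulNr mulrN.
  have := NA y; rewrite -(ler_pM2l (_ : 0 < c^-1 ^+ 2)) ?exprn_gt0 ?invr_gt0 //.
  rewrite (_ : c^-1 ^+ 2 * (c * n y) = c^-1 * n y); last by field; rewrite gt_eqF.
  by move=> ?; lra.
(* After [k] descents, each lowering the squared norm by at least [d / c], it would be negative. *)
have [k kP] : exists k : nat, N x < k%:R * (c^-1 * d).
  have p : 0 < c^-1 * d by rewrite mulr_gt0 // invr_gt0.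
  exists (Num.truncn (N x / (c^-1 * d))).+1; rewrite -ltr_pdivrMr //.
  exact: truncnS_gt.
have [w wP] : exists w, N (x - A w) <= N x - k%:R * (c^-1 * d).
  elim: (k) => [|m [w wP]]; first by exists 0; rewrite raddf0 subr0 mul0r subr0.
  exists (w + c^-1%:C *: (x - A w)).
  have -> : x - A (w + c^-1%:C *: (x - A w)) =
      x - A w + (- c^-1)%:C *: A (x - A w).
    by rewrite linearD linearZ /= opprD addrA rmorphN /= scaleNr.
  apply: le_trans (descent _) _.
  have /negP := far w; rewrite -ltNge -(ltr_pM2l (_ : 0 < c^-1)) ?invr_gt0 // => ?.
  rewrite -natr1; lra.
by have := N_ge0 (x - A w); lra.
Qed.

Lemma seminormA_ge0 x : 0 <= seminormA dot A x. Proof. exact: sqrtr_ge0. Qed.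

Lemma seminormAN x : seminormA dot A (- x) = seminormA dot A x.
Proof.
rewrite /seminormA -/f -scaleN1r (sesqformZ _ _ fs).
by rewrite rmorphN1 mulrNN !mul1r.
Qed.

Lemma seminormA_triangle x y :
  seminormA dot A (x + y) <= seminormA dot A x + seminormA dot A y.
Proof.
have p := addr_ge0 (seminormA_ge0 x) (seminormA_ge0 y).
rewrite -(ler_pXn2r (_ : 0 < 2)%N) ?nnegrE ?seminormA_ge0 // sqrrD.
rewrite !seminormA_sqr (sqnDD fs fh fp).
have : Re (f x y) <= seminormA dot A x * seminormA dot A y.
  apply: le_trans (ler_norm _) _.
  rewrite -(ler_pXn2r (_ : 0 < 2)%N) ?nnegrE ?mulr_ge0 ?seminormA_ge0 //.
  rewrite exprMn !seminormA_sqr real_normK ?num_real //.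
  by apply: le_trans (cauchy_schwarz fs fh fp x y); rewrite lerDl sqr_ge0.
by rewrite -mulr_natl => ?; lra.
Qed.

(** * The operator seminorm *)

Section operator.
Context (U : {linear H -> H}) (c : R).
Hypothesis c0 : 0 <= c.
Hypothesis Uc : forall x, seminormA dot A (U x) <= c * seminormA dot A x.

Lemma opnormA_ubound : ubound [set seminormA dot A (U x) / seminormA dot A x |
  x in [set x | closure (range A) x /\ x != 0]] c.
Proof.
move=> _ [x _ <-]; have [->|nz] := eqVneq (seminormA dot A x) 0.
  by rewrite invr0 mulr0.
by rewrite ler_pdivrMr // lt_def nz seminormA_ge0.
Qed.

Lemma opnormA_ge0 : 0 <= opnormA dot A U.
Proof.
rewrite /opnormA; set E := (X in sup X).
have [->|/set0P [e Ee]] := eqVneq E set0; first by rewrite sup0.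
apply: le_trans (_ : e <= _).
  by case: Ee => x _ <-; rewrite divr_ge0 // seminormA_ge0.
by apply: sup_upper_bound => //; split; [exists e|exists c; exact: opnormA_ubound].
Qed.

Lemma opnormA_le : opnormA dot A U <= c.
Proof.
rewrite /opnormA; set E := (X in sup X).
have [->|/set0P En] := eqVneq E set0; first by rewrite sup0.
exact: (sup_le_ub En opnormA_ubound).
Qed.

(** The supremum only sees the closed range of [A]; a general [x] is approximated in seminorm by
    vectors [A w], and [Uc] controls the image of the error. *)
Lemma seminormA_le_opnormA x :
  seminormA dot A (U x) <= opnormA dot A U * seminormA dot A x.
Proof.
have rangeP w : seminormA dot A (U (A w)) <= opnormA dot A U * seminormA dot A (A w).
  have [e|nz] := eqVneq (seminormA dot A (A w)) 0.
    by have := Uc (A w); rewrite e !mulr0.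
  rewrite -ler_pdivrMr ?lt_def ?nz ?seminormA_ge0 //.
  have Ew : [set seminormA dot A (U x) / seminormA dot A x |
      x in [set x | closure (range A) x /\ x != 0]]
      (seminormA dot A (U (A w)) / seminormA dot A (A w)).
    exists (A w) => //; split; first by apply: subset_closure; exists w.
    apply: contra_neq nz => ->.
    by rewrite /seminormA -/f (sesqform0 fs) sqrtr0.
  apply: sup_upper_bound => //; split; last by exists c; exact: opnormA_ubound.
  by eexists; exact: Ew.
apply/ler_addgt0Pr => e e0.
(* The error [x - A w] enters once with factor [opnormA dot A U] and once with factor [c]; the added
   1 makes [K] positive. *)
pose K := opnormA dot A U + c + 1.
have K0 : 0 < K by rewrite ltr_wpDl // addr_ge0 // opnormA_ge0.
have [w wP] := range_dense x (exprn_gt0 2 (divr_gt0 e0 K0)).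
have sw : seminormA dot A (x - A w) <= e / K.
  rewrite -(ler_pXn2r (_ : 0 < 2)%N) ?nnegrE ?seminormA_ge0 ?divr_ge0 ?(ltW e0) ?(ltW K0) //.
  by rewrite seminormA_sqr.
have t1 : seminormA dot A (U x) <=
    seminormA dot A (U (A w)) + seminormA dot A (U (x - A w)).
  have {1}-> : U x = U (A w) + U (x - A w) by rewrite -linearD subrKC.
  exact: seminormA_triangle.
have t2 : seminormA dot A (A w) <= seminormA dot A x + seminormA dot A (x - A w).
  rewrite -{1}(subKr x (A w)); apply: le_trans (seminormA_triangle _ _) _.
  by rewrite seminormAN.
have := rangeP w; have := Uc (x - A w); have := ler_wpM2l opnormA_ge0 t2.
have : K * seminormA dot A (x - A w) <= e.
  by rewrite mulrC -ler_pdivlMr.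
have := seminormA_ge0 (x - A w); rewrite /K; lra.
Qed.

End operator.

End A_seminorm.

(** * The distance formula *)

Theorem theorem3p3 (R : realType) (H : completeNormedModType R[i])
    (dot : {dot H for (@Num.conj R[i])}) (dot_norm : induces_norm dot)
    (A : {linear H -> H}) (A_bnd : bounded_near A (nbhs (0 : H)))
    (A_pos : positive_op dot A)
    (T : {linear H -> H}) (T_bnd : bounded_near T (nbhs (0 : H)))
    (T_Abnd : A_bounded dot A T)
    (S : {linear H -> H}) (S_bnd : bounded_near S (nbhs (0 : H)))
    (S_Abnd : A_bounded dot A S) :
  distA dot A T S =
  sup [set r : R | exists x y : H,
         [/\ seminormA dot A x = 1, seminormA dot A y = 1,
             orthA dot A (S x) y & r = Normc.normc (dotA dot A (T x) y)]].
Proof.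
set f := dotA dot A.
have fs : sesqform f by exact: dotA_sesqform.
have fh x y : f y x = conjc (f x y) by exact: dotA_hermitian.
have fp x : 0 <= f x x by exact: A_pos.
have s0 x : 0 <= seminormA dot A x by exact: sqrtr_ge0.
have sE x : seminormA dot A x ^+ 2 = sqn f x by exact: seminormA_sqr.
have [cT cT0 Tb] := T_Abnd; have [cS cS0 Sb] := S_Abnd.
have sqb (U : H -> H) (c : R) : 0 < c ->
    (forall x, seminormA dot A (U x) <= c * seminormA dot A x) ->
    forall x, sqn f (U x) <= c ^+ 2 * sqn f x.
  move=> c0 Ub x; rewrite -!sE -exprMn ler_pXn2r ?nnegrE ?Ub //.
  by rewrite mulr_ge0 // ltW.
pose P g : {linear H -> H} := T \+ g \*: S.
have Pb g : exists2 c : R, 0 <= c &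
    forall x, seminormA dot A (P g x) <= c * seminormA dot A x.
  have sZ x : seminormA dot A (g *: x) =
      Num.sqrt (Re g ^+ 2 + Im g ^+ 2) * seminormA dot A x.
    by rewrite /seminormA -/f -/(sqn f _) sqnZ // sqrtrM // addr_ge0 // sqr_ge0.
  exists (cT + Num.sqrt (Re g ^+ 2 + Im g ^+ 2) * cS).
    by rewrite addr_ge0 ?mulr_ge0 ?sqrtr_ge0 // ltW.
  move=> x; rewrite /P /=; apply: le_trans (seminormA_triangle A_pos _ _) _.
  by rewrite sZ mulrDl lerD // -mulrA ler_wpM2l ?sqrtr_ge0.
have normcE (z : R[i]) : Normc.normc z ^+ 2 = Re z ^+ 2 + Im z ^+ 2.
  by case: z => u v /=; rewrite sqr_sqrtr // addr_ge0 // sqr_ge0.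
have normc0 (z : R[i]) : 0 <= Normc.normc z by case: z => u v; exact: sqrtr_ge0.
have cs x y : Normc.normc (f x y) <= seminormA dot A x * seminormA dot A y.
  rewrite -(ler_pXn2r (_ : 0 < 2)%N) ?nnegrE ?mulr_ge0 //.
  by rewrite exprMn !sE normcE; exact: cauchy_schwarz.
set E := (X in sup X); set M := sup E.
(* As [S x] is orthogonal to [y], replacing [T] by [P g] does not change the product with [y]. *)
have Eub g : ubound E (opnormA dot A (P g)).
  move=> _ [x [y [x1 y1 Sxy ->]]]; have [c c0 Uc] := Pb g.
  have -> : f (T x) y = f (P g x) y.
    case: fs => fl _; rewrite /P /= addrC fl.
    by rewrite (_ : f (S x) y = 0) ?mulr0 ?add0r.
  apply: le_trans (cs _ _) _; rewrite y1 mulr1.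
  have := seminormA_le_opnormA dot_norm A_bnd A_pos c0 Uc x.
  by rewrite x1 mulr1.
have M_le g : M <= opnormA dot A (P g).
  have [c c0 Uc] := Pb g.
  (* An empty [E] has supremum 0, which is still below the operator seminorm. *)
  rewrite /M; have [->|/set0P En] := eqVneq E set0.
    by rewrite sup0; exact: opnormA_ge0 Uc.
  exact: sup_le_ub (Eub g).
have leM r : E r -> r <= M.
  move=> Er; apply: sup_upper_bound => //; split; first by exists r.
  by exists (opnormA dot A (P 0)); exact: Eub.
have M0 : 0 <= M.
  have [E0|/set0P [r Er]] := eqVneq E set0; first by rewrite /M E0 sup0.
  by apply: le_trans (leM _ Er); case: Er => x [y [_ _ _ ->]].
(* The test pair is [x] and [u = P g x], normalised: [u] is orthogonal to [S x], so the product of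
   [T x] and [u] is that of [u] with itself, and the pair yields the ratio [a / b] of their
   seminorms. If [u] is not null, neither is [x], because [P g] is bounded for the seminorm. *)
have hyp g x : f (T x + g *: S x) (S x) = 0 ->
    sqn f (T x + g *: S x) <= M ^+ 2 * sqn f x.
  rewrite -[T x + g *: S x]/(P g x) => orth.
  have [c c0 Uc] := Pb g.
  have [u0|un] := eqVneq (seminormA dot A (P g x)) 0.
    by rewrite -!sE u0 expr0n /= mulr_ge0 // sqr_ge0.
  have up : 0 < seminormA dot A (P g x) by rewrite lt_def un s0.
  have xp : 0 < seminormA dot A x.
    rewrite lt_def s0 andbT; apply: contra_neq un => x0.
    by apply/eqP; rewrite eq_le s0 andbT; have := Uc x; rewrite x0 mulr0.
  set u := P g x in orth up un *.
  set a := seminormA dot A u in up un *; set b := seminormA dot A x in xp *.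
  have sZ (k : R) z : 0 <= k ->
      seminormA dot A (k%:C *: z) = k * seminormA dot A z.
    move=> k0; rewrite /seminormA -/f -/(sqn f _) sqnZ //= expr0n addr0.
    by rewrite sqrtrM ?sqr_ge0 // sqrtr_sqr ger0_norm.
  have fZ (k l : R) v z : f (k%:C *: v) (l%:C *: z) = (k * l)%:C * f v z.
    by rewrite sesqformZl // sesqformZr // conjc_real mulrA rmorphM.
  have Tu : f (T x) u = (a ^+ 2)%:C.
    have Su : f (S x) u = 0 by rewrite fh orth conjc0.
    by case: (fs) => fl _; rewrite /a sE -(form_sqn fp) {2}/u /P /= addrC fl Su mulr0 add0r.
  have := leM (b^-1 * a^-1 * a ^+ 2) _.
  rewrite (_ : b^-1 * a^-1 * a ^+ 2 = a / b); last by field; rewrite !gt_eqF.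
  rewrite ler_pdivrMr // => le.
  rewrite -!sE -exprMn ler_pXn2r ?nnegrE ?mulr_ge0 //; apply: le.
  exists (b^-1%:C *: x), (a^-1%:C *: u); split.
  - by rewrite sZ ?invr_ge0 ?ltW // mulVf ?gt_eqF.
  - by rewrite sZ ?invr_ge0 ?ltW // mulVf ?gt_eqF.
  - by rewrite /orthA -/f linearZ fZ (fh u) orth conjc0 mulr0.
  - rewrite -/f linearZ fZ Tu -rmorphM /= expr0n addr0 sqrtr_sqr ger0_norm.
      by field; rewrite !gt_eqF.
    by apply: mulr_ge0; [rewrite mulr_ge0 ?invr_ge0 ?ltW|exact: sqr_ge0].
(* The pencil is treated with squared seminorms, hence the squares of [cT], [cS] and [M]. *)
have [g gP] := pencil_bound fs fh fp (sqr_ge0 cT) (sqb _ _ cT0 Tb)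
  (sqr_ge0 cS) (sqb _ _ cS0 Sb) hyp.
(* The [g] found above gives one inequality. [M_le] gives the other, and also the lower bound that
   makes the infimum meaningful. *)
apply/eqP; rewrite eq_le; apply/andP; split.
  apply: le_trans (_ : opnormA dot A (P g) <= _).
    apply: ge_inf; last by exists g.
    by exists M => _ [h _ <-]; exact: M_le h.
  apply: opnormA_le => // x; rewrite -(ler_pXn2r (_ : 0 < 2)%N) ?nnegrE ?mulr_ge0 //.
  by rewrite exprMn !sE; exact: gP.
apply: lb_le_inf; first by exists (opnormA dot A (P 0)), 0.
by move=> _ [h _ <-]; exact: M_le h.
Qed.
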